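(* Let $\mu_0,\mu_1\in RMM_d$, where $$\mathrm{d}\mu_j(x)=\sum_{k=1}^{K_j}\pi_j^k\,\mathrm{d}\nu_j^k(x),\qquad \nu_j^k=R_d(m_j^k,c_j^k,\rho_j),\qquad j=0,1,$$ and let $w^*$ be a solution of $$\min_{w\in\Pi(\pi_0,\pi_1)}\ \sum_{k=1}^{K_0}\sum_{l=1}^{K_1} w_{kl}\,W_2(\nu_0^k,\nu_1^l)^2 .$$ Then $$RW_2(\mu_0,\mu_1)=\sqrt{\sum_{k=1}^{K_0}\sum_{l=1}^{K_1} w^*_{kl}\,W_2(\nu_0^k,\nu_1^l)^2}$$ is a distance on $RMM_d$.
   Context: Let $d\ge 1$ be an integer. $\mathcal{P}_2(\mathbb{R}^d)$ is the set of Borel probability measures on $\mathbb{R}^d$ with finite second moment, and $W_2$ is the Wasserstein distance on it: $W_2(\mu,\nu)^2=\inf_{\gamma}\int_{\mathbb{R}^d\times\mathbb{R}^d}\|x-y\|^2\,\mathrm{d}\gamma(x,y)$, the infimum being over probability measures $\gamma$ on $\mathbb{R}^d\times\mathbb{R}^d$ with marginals $\mu$ and $\nu$. $\Gamma_K$ denotes the probability simplex in $\mathbb{R}^K$. Radially contoured distributions: for $m\in\mathbb{R}^d$, $c>0$ and a generator $\rho$, which is either a nonnegative continuous function on $[0,\infty)$ or the Dirac $\delta$ function, $R_d(m,c,\rho)$ is the probability measure $\frac1Z\rho\left(\frac{\|x-m\|}{c}\right)\mathrm{d}x$ on $\mathbb{R}^d$, with $Z$ the normalizing constant (when $\rho$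 is the Dirac $\delta$, this is the point mass at $m$). It is always assumed that these measures belong to $\mathcal{P}_2(\mathbb{R}^d)$. Radial mixtures: for a generator $\rho$, $RMM_d(\rho)$ is the set of all finite mixtures $\mu=\sum_{k=1}^K\pi^k\nu^k$ with $K\ge1$, $\pi=(\pi^1,\dots,\pi^K)\in\Gamma_K$ and $\nu^k=R_d(m^k,c^k,\rho)$. $RMM_d(\rho)$ is called identifiable if, for any two mixtures $\mu_j=\sum_{k=1}^{K_j}\pi_j^k\nu_j^k$ in $RMM_d(\rho)$ ($j=0,1$) with $\nu_j^k\ne\nu_j^l$ for all $1\le k<l\le K_j$, one has $\mu_0=\mu_1$ if and only if $K_0=K_1$ and there is a permutation $\sigma$ of $\{1,\dots,K_0\}$ with $\pi_0^{\sigma(k)}=\pi_1^k$ and $\nu_0^{\sigma(k)}=\nu_1^k$ for all $k$. Finally $RMM_d=\bigcup_\rho RMM_d(\rho)$, the union being over all generators $\rho$ for which $RMM_d(\rho)$ is identifiable. For weight vectors $\pi_0\in\Gamma_{K_0}$, $\pi_1\in\Gamma_{K_1}$, $\Pi(\pi_0,\pi_1)$ is the set of nonnegative $K_0\times K_1$ matrices $w$ with $\sum_l w_{kl}=\pi_0^k$ for all $k$ and $\sum_k w_{kl}=\pi_1^l$ for all $l$.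
   Formalization: RW_2 depends on the generators used, so one admissible generator is fixed for each distribution (any such choice) and decompositions use it; identifiability is taken for positive weights, since with zero weights allowed no RMM_d(ρ) is identifiable. *)

(* Defs.v *)
From HB Require Import structures.
From mathcomp Require Import all_boot all_order all_algebra all_fingroup.
From mathcomp Require Import all_classical all_reals all_analysis.

Set Implicit Arguments.
Unset Strict Implicit.
Unset Printing Implicit Defensive.
Import Order.TTheory GRing.Theory Num.Theory.
Import numFieldNormedType.Exports.

Local Open Scope classical_set_scope.
Local Open Scope ring_scope.

(* R^d with the product sigma-algebra of its coordinates, which is the Borel
   sigma-algebra. *)
Notation Rd R d := (d.-tuple (measurableTypeR R)).

Definition vsub (R : realType) (d : nat) (x y : Rd R d) : Rd R d :=
  [tuple tnth x i - tnth y i | i < d].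

Definition enorm (R : realType) (d : nat) (x : Rd R d) : R :=
  Num.sqrt (\sum_(i < d) tnth x i ^+ 2).

(* The image of lebesgue_measure \x ... \x lebesgue_measure under the
   identification of R * R^n with R^n.+1. *)
Fixpoint lebesgue_Rd (R : realType) (n : nat) : set (Rd R n) -> \bar R :=
  match n with
  | 0 => \d_([tuple] : Rd R 0)
  | n'.+1 =>
      pushforward (@lebesgue_measure R \x @lebesgue_Rd R n')%E
        (fun p : measurableTypeR R * Rd R n' =>
           [tuple of p.1 :: p.2] : Rd R n'.+1)
  end.

(* Set functions, and in particular the values of type [probability], are
   defined on non-measurable sets too, so Leibniz equality is too fine. *)
Definition meas_eq (disp : measure_display) (T : measurableType disp)
    (R : realType) (mu nu : set T -> \bar R) : Prop :=
  forall A, measurable A -> mu A = nu A.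

Section wasserstein.
Context (R : realType) (d : nat).
Implicit Types mu nu : set (Rd R d) -> \bar R.

Definition second_moment mu : \bar R := (\int[mu]_x ((enorm x) ^+ 2)%:E)%E.

Definition coupling mu nu : set (probability (Rd R d * Rd R d)%type R) :=
  [set gamma | (forall A, measurable A -> gamma (A `*` setT) = mu A) /\
               (forall B, measurable B -> gamma (setT `*` B) = nu B)].

Definition W2 mu nu : R :=
  Num.sqrt (fine (ereal_inf
    [set (\int[gamma]_p ((enorm (vsub p.1 p.2)) ^+ 2)%:E)%E
    | gamma in coupling mu nu])).

End wasserstein.

Inductive generator (R : realType) :=
  | Density of R -> R
  | DiracGenerator.
Arguments DiracGenerator {R}.

Section radial.
Context (R : realType) (d : nat).
Implicit Types (m : Rd R d) (c : R) (rho : generator R).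

(* f is a function on all of R; only its values on [0, +oo[ are used. *)
Definition radial_mass m c (f : R -> R) : \bar R :=
  (\int[@lebesgue_Rd R d]_x (f (enorm (vsub x m) / c))%:E)%E.

Definition radial m c rho : set (Rd R d) -> \bar R :=
  match rho with
  | Density f => fun A =>
      ((fine (radial_mass m c f))^-1%:E *
       \int[@lebesgue_Rd R d]_(x in A) (f (enorm (vsub x m) / c))%:E)%E
  | DiracGenerator => \d_m
  end.

(* rho is a generator, and R_d(m, c, rho) is a probability measure with finite
   second moment for all m and c > 0. *)
Definition is_generator rho : Prop :=
  match rho with
  | Density f =>
      [/\ {within `[0, +oo[, continuous f},
          (forall r, 0 <= r -> 0 <= f r) &
          forall m c, 0 < c ->
            (0 < radial_mass m c f < +oo)%E /\
            (second_moment (radial m c rho) < +oo)%E]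
  | DiracGenerator => True
  end.

(* Weights lie in the closed simplex, and components may be repeated. *)
Record mixture := Mixture {
  ncomp : nat;
  weight : 'I_ncomp -> R;
  center : 'I_ncomp -> Rd R d;
  scale : 'I_ncomp -> R;
  weight_ge0 : forall k, 0 <= weight k;
  weight_sum1 : \sum_k weight k = 1;
  scale_gt0 : forall k, 0 < scale k
}.

Definition component rho (p : mixture) (k : 'I_(ncomp p)) :
    set (Rd R d) -> \bar R :=
  radial (center k) (scale k) rho.

Definition mixture_law rho (p : mixture) : set (Rd R d) -> \bar R :=
  fun A => (\sum_k (weight k)%:E * component (p := p) rho k A)%E.

Definition RMM_gen rho : set (probability (Rd R d) R) :=
  [set mu | exists p, meas_eq mu (mixture_law rho p)].

(* The components carry positive weight and are pairwise distinct. *)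
Definition reduced rho (p : mixture) : Prop :=
  (forall k, 0 < weight (m := p) k) /\
  (forall k l : 'I_(ncomp p), k != l ->
     ~ meas_eq (component rho k) (component rho l)).

(* Without positivity of the weights no RMM_gen rho would be identifiable, as
   nu = 1 * nu + 0 * nu'. *)
Definition identifiable rho : Prop :=
  forall p0 p1 : mixture, reduced rho p0 -> reduced rho p1 ->
    meas_eq (mixture_law rho p0) (mixture_law rho p1) <->
    exists (eqK : ncomp p1 = ncomp p0) (s : 'S_(ncomp p0)),
      forall k : 'I_(ncomp p1),
        weight (s (cast_ord eqK k)) = weight k /\
        meas_eq (component rho (s (cast_ord eqK k))) (component rho k).

Definition RMM : set (probability (Rd R d) R) :=
  [set mu | exists rho, [/\ is_generator rho, identifiable rho
                          & RMM_gen rho mu]].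

Definition transport_plan (p0 p1 : mixture) :
    set 'M[R]_(ncomp p0, ncomp p1) :=
  [set w | [/\ forall k l, 0 <= w k l,
               forall k, \sum_l w k l = weight k
             & forall l, \sum_k w k l = weight l]].

Definition plan_cost rho0 rho1 (p0 p1 : mixture)
    (w : 'M[R]_(ncomp p0, ncomp p1)) : R :=
  \sum_k \sum_l w k l * W2 (component rho0 k) (component rho1 l) ^+ 2.

Definition optimal_plan rho0 rho1 (p0 p1 : mixture)
    (w : 'M[R]_(ncomp p0, ncomp p1)) : Prop :=
  transport_plan w /\
  forall w' : 'M[R]_(ncomp p0, ncomp p1), transport_plan w' ->
    plan_cost rho0 rho1 w <= plan_cost rho0 rho1 w'.

(* Distributions in RMM may be mixtures for several generators (a generator
   can itself be a mixture of rescalings of another one), with different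
   decompositions; [rho_of] records the one used for each distribution. *)
Definition generator_choice
    (rho_of : probability (Rd R d) R -> generator R) : Prop :=
  (forall mu, RMM mu ->
     [/\ is_generator (rho_of mu), identifiable (rho_of mu)
       & RMM_gen (rho_of mu) mu]) /\
  (forall mu nu, RMM mu -> RMM nu -> meas_eq mu nu -> rho_of mu = rho_of nu).

Definition is_distance_on (S : set (probability (Rd R d) R))
    (D : probability (Rd R d) R -> probability (Rd R d) R -> R) : Prop :=
  [/\ forall mu nu, S mu -> S nu -> 0 <= D mu nu,
      forall mu nu, S mu -> S nu -> (D mu nu = 0 <-> meas_eq mu nu),
      forall mu nu, S mu -> S nu -> D mu nu = D nu mu
    & forall mu nu xi, S mu -> S nu -> S xi -> D mu xi <= D mu nu + D nu xi].

End radial.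

(* Main.v *)
Require Import Defs.
From HB Require Import structures.
From mathcomp Require Import all_boot all_order all_algebra all_fingroup.
From mathcomp Require Import all_classical all_reals all_analysis.
From mathcomp Require Import measurable_realfun ring lra.
Import Order.TTheory GRing.Theory Num.Theory.
Import numFieldNormedType.Exports.
Local Open Scope classical_set_scope.
Local Open Scope ring_scope.
Set Implicit Arguments.
Unset Strict Implicit.
Unset Printing Implicit Defensive.

(** Let MD(p, q) be the square root of the optimal cost between two mixtures p
and q, each with its own generator ([mixture_distance]).  The theorem follows
from three facts about MD, once the transport polytope is known to be compact,
so that optimal plans exist ([exists_optimal_plan]).

- MD satisfies the triangle inequality ([mixture_distance_triangle]): two plans
  glue through the common marginal, w_km = sum_l w_kl v_lm / pi_l, and the
  ground cost W2 satisfies the triangle inequality.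
- MD(p, q) = 0 forces the laws to agree ([mixture_distance_eq0]): an optimal
  plan of cost zero charges only pairs of components at W2-distance zero, that
  is, pairs of equal components, so it rewrites one mixture as the other.
- MD(p, q) = 0 when p and q have the same law for one identifiable generator
  ([mixture_distance_same_law]): merging equal components and dropping null
  weights puts p and q in reduced form without changing the mass given to each
  component measure, identifiability says that the reduced forms coincide up to
  order, and sharing each mass in proportion to the weights is a plan of cost
  zero.

By the triangle inequality, the third fact also shows that MD depends only on
the laws and not on the decompositions, so that RW2 is well defined.

The ground distance W2 needs its own proof.  The triangle inequality
([W2_triangle]) usually glues couplings along a disintegration of the middle
marginal.  A discrete version suffices: cut the space into countably many cells
of diameter at most e and make the two couplings independent given the cell of
their middle coordinates ([exists_gluing]).  The two middle points then differ
by at most e, and e is arbitrary.  Minkowski's inequality in L2 is replaced by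
(a + b + c)^2 <= (s + t + u) (a^2/s + b^2/t + c^2/u), which is integrated term by
term and becomes the triangle inequality for the best s, t, u.  That W2 = 0
implies equality ([W2_eq0]) is seen on the products of half-lines ]-oo, a_i[:
by Markov's inequality a cheap coupling moves little mass out of a slightly
smaller box.  All of this requires the components to be genuine probability
measures of finite second moment, hence lebesgue_Rd to be a measure
([lebesgue_Rd_sigma_finite], [radial_probability]). *)

(** * Weighted square inequalities and existence of optimal plans *)

Section scalar.
Context {R : realType}.
Implicit Types a b c s t u x : R.

Lemma sqr_add2_le a b s t : 0 < s -> 0 < t ->
  (a + b) ^+ 2 <= (s + t) * (a ^+ 2 / s + b ^+ 2 / t).
Proof.
move=> s0 t0; rewrite -subr_ge0.
have -> : (s + t) * (a ^+ 2 / s + b ^+ 2 / t) - (a + b) ^+ 2 =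
  (a * t - b * s) ^+ 2 / (s * t).
  by field; rewrite ?gt_eqF.
by rewrite divr_ge0 ?sqr_ge0 // mulr_ge0 // ltW.
Qed.

Lemma sqr_add3_le a b c s t u : 0 < s -> 0 < t -> 0 < u ->
  (a + b + c) ^+ 2 <= (s + t + u) * (a ^+ 2 / s + b ^+ 2 / t + c ^+ 2 / u).
Proof.
move=> s0 t0 u0; have st0 : 0 < s + t by rewrite addr_gt0.
apply: (le_trans (sqr_add2_le (a + b) c st0 u0)).
apply: ler_wpM2l; first by rewrite addr_ge0 // ltW.
rewrite lerD2r ler_pdivrMr// mulrC.
exact: sqr_add2_le.
Qed.

(** Turns the weighted square inequalities into triangle inequalities: the bound
s + t is obtained for weights s, t slightly above the two distances, which are
positive even when a distance vanishes. *)
Lemma le_add_of_gt x a b : (forall s t, a < s -> b < t -> x <= s + t) ->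
  x <= a + b.
Proof.
move=> h; apply/ler_addgt0Pr => e e0.
by apply: (le_trans (h (a + e / 2) (b + e / 2) _ _)); lra.
Qed.

End scalar.

Section plan.
Context {R : realType} {d : nat}.
Implicit Types p : mixture R d.

Lemma weight_prod_plan p0 p1 :
  transport_plan (\matrix_(k, l) (@weight _ _ p0 k * @weight _ _ p1 l)).
Proof.
split=> [k l|k|l].
- by rewrite mxE mulr_ge0 ?weight_ge0.
- by under eq_bigr do rewrite mxE; rewrite -mulr_sumr weight_sum1 mulr1.
- by under eq_bigr do rewrite mxE; rewrite -mulr_suml weight_sum1 mul1r.
Qed.

Lemma weight_le1 p k : @weight _ _ p k <= 1.
Proof.
by rewrite -(@weight_sum1 _ _ p) (bigD1 k)//= lerDl sumr_ge0// => i _; exact: weight_ge0.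
Qed.

Lemma plan_le1 p0 p1 w k l : @transport_plan R d p0 p1 w -> w k l <= 1.
Proof.
move=> [w0 w1 _]; apply: le_trans (weight_le1 k); rewrite -w1 (bigD1 l)//=.
by rewrite lerDl sumr_ge0.
Qed.

(** Plans have entries in [0, 1] and are cut out by closed conditions, so they form
a compact set on which the linear cost attains its minimum. *)
Lemma exists_optimal_plan rho0 rho1 p0 p1 :
  exists w : 'M[R]_(ncomp p0, ncomp p1), optimal_plan rho0 rho1 w.
Proof.
set n0 := ncomp p0; set n1 := ncomp p1.
pose crd k l (v : 'rV[R]_(n0 * n1)) : R := v ord0 (mxvec_index k l).
have crdE k l v : vec_mx v k l = crd k l v by rewrite mxE.
have ccrd k l : continuous (crd k l) by exact: coord_continuous.
pose A := [set v : 'rV[R]_(n0 * n1) | transport_plan (p0 := p0) (p1 := p1) (vec_mx v)].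
pose f v : R := plan_cost (p0 := p0) (p1 := p1) rho0 rho1 (vec_mx v).
have csum (I : finType) (g : I -> 'rV[R]_(n0 * n1) -> R) :
    (forall i, continuous (g i)) -> continuous (fun v => \sum_i g i v).
  move=> cg; apply: continuous_big => //; exact: add_continuous.
have cf : continuous f.
  have -> : f = fun v => \sum_k \sum_l crd k l v *
      W2 (component rho0 k) (component rho1 l) ^+ 2.
    apply/funext => v; apply: eq_bigr => k _; apply: eq_bigr => l _.
    by rewrite crdE.
  apply: (csum) => k; apply: (csum) => l v.
  by apply: continuousM; [exact: ccrd|exact: cst_continuous].
have cA : compact A.
  apply: (@subclosed_compact _ _
    [set v : 'rV[R]_(n0 * n1) | forall i, `[0, 1]%classic (v ord0 i)]).
  - have -> : A = (\bigcap_(kl : 'I_n0 * 'I_n1) (crd kl.1 kl.2 @^-1` [set x | 0 <= x]))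
       `&` ((\bigcap_(k : 'I_n0) ((fun v => \sum_l crd k l v) @^-1` [set x | x = weight k]))
       `&` (\bigcap_(l : 'I_n1) ((fun v => \sum_k crd k l v) @^-1` [set x | x = weight l]))).
      apply/seteqP; split=> v.
        move=> [v0 v1 v2]; split; first by move=> [k l] _ /=; rewrite -crdE.
        split=> [k _|l _] /=; [rewrite -v1|rewrite -v2];
          by apply: eq_bigr => i _; rewrite crdE.
      move=> [v0 [v1 v2]]; split=> [k l|k|l].
      + by rewrite crdE; exact: (v0 (k, l)).
      + by rewrite -(v1 k I); apply: eq_bigr => i _; rewrite crdE.
      + by rewrite -(v2 l I); apply: eq_bigr => i _; rewrite crdE.
    apply: closedI; last apply: closedI; apply: closed_bigI => i _; apply: preimage_closed.
    + by move=> v _; exact: ccrd.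
    + exact: closed_ge.
    + by move=> v _; apply: (csum) => l; exact: ccrd.
    + exact: closed_eq.
    + by move=> v _; apply: (csum) => l; exact: ccrd.
    + exact: closed_eq.
  - by apply: (@rV_compact R _ (fun=> `[0, 1]%classic)) => i; exact: segment_compact.
  - move=> v Av i; case/mxvec_indexP: i => k l.
    have [v0 _ _] := Av; rewrite /= in_itv /= -/(crd k l v) -crdE v0.
    exact: (plan_le1 k l Av).
have A0 : A !=set0.
  exists (mxvec (\matrix_(k, l) (@weight _ _ p0 k * @weight _ _ p1 l))).
  by rewrite /A /= mxvecK; exact: weight_prod_plan.
have [v vA vmin] := @compact_EVT_min _ _ f A A0 cA (continuous_subspaceT cf).
exists (vec_mx v); split; first by move: vA; rewrite inE.
move=> w' pw'; have := vmin (mxvec w'); rewrite /f mxvecK; apply.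
by rewrite inE /A /= mxvecK.
Qed.

End plan.

(** * Radially contoured distributions are probability measures *)

Section measures.
Context {R : realType}.

Section probability_of_measure.
Context {disp} {T : measurableType disp}.
Variables (mu : {measure set T -> \bar R}) (mu1 : mu setT = 1%E).

(** A copy of mu, so that the probability structure can be attached to it. *)
Definition as_probability (_ : mu setT = 1%E) : set T -> \bar R := mu.

HB.instance Definition _ := Measure.copy (as_probability mu1) mu.
HB.instance Definition _ :=
  Measure_isProbability.Build _ _ _ (as_probability mu1) mu1.

End probability_of_measure.

Section sigma_finite_of_measure.
Context {disp} {T : measurableType disp}.
Variables (mu : {measure set T -> \bar R}) (muT : sigma_finite setT mu).

(** Same device as [as_probability]. *)
Definition as_sigma_finite (_ : sigma_finite setT mu) : set T -> \bar R := mu.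

HB.instance Definition _ := Measure.copy (as_sigma_finite muT) mu.
HB.instance Definition _ :=
  Measure_isSigmaFinite.Build _ _ _ (as_sigma_finite muT) muT.

End sigma_finite_of_measure.

(** Sigma-finiteness is part of the induction because the product with a further
copy of Lebesgue measure is a measure only over a sigma-finite factor; the
measurable inverse of (a, x) |-> a :: x transports a sigma-finite cover. *)
Lemma lebesgue_Rd_sigma_finite n :
  exists L : {sigma_finite_measure set (Rd R n) -> \bar R},
    (L : set (Rd R n) -> \bar R) = @lebesgue_Rd R n.
Proof.
elim: n => [|n [L IH]].
  by exists (\d_([tuple] : Rd R 0)).
pose cns (p : measurableTypeR R * Rd R n) : Rd R n.+1 := [tuple of p.1 :: p.2].
pose unc (x : Rd R n.+1) : measurableTypeR R * Rd R n := (thead x, [tuple of behead x]).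
have mcns : measurable_fun setT cns by exact: measurable_cons.
have munc : measurable_fun setT unc.
  apply/measurable_fun_pairP; split; first exact: measurable_tnth.
  exact: measurable_behead.
have cnsK : cancel cns unc.
  by move=> [a x]; congr pair; exact: val_inj.
have uncK : cancel unc cns by move=> x; rewrite /unc /cns /= -tuple_eta.
pose prd : {measure set (measurableTypeR R * Rd R n)%type -> \bar R} :=
  (@lebesgue_measure R \x L)%E.
pose mu : {measure set (Rd R n.+1) -> \bar R} :=
  measure_function_pushforward__canonical__measure_function_Measure prd mcns.
have sf : sigma_finite setT mu.
  have /sigma_finiteP[F [FT ndF Foo]] := sigma_finiteT (@lebesgue_measure R).
  have /sigma_finiteP[G [GT ndG Goo]] := sigma_finiteT L.
  exists (fun k => unc @^-1` (F k `*` G k)).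
    rewrite -preimage_bigcup -[LHS](preimage_setT unc); congr (_ @^-1` _).
    apply/esym/seteqP; split=> // -[x y] _.
    have [i _ Fix] : (\bigcup_i F i) x by rewrite -FT.
    have [j _ Gjy] : (\bigcup_j G j) y by rewrite -GT.
    exists (maxn i j) => //; split => /=.
      by move: x Fix; exact/subsetPset/ndF/leq_maxl.
    by move: y Gjy; exact/subsetPset/ndG/leq_maxr.
  move=> k; have [mF Fkoo] := Foo k; have [mG Gkoo] := Goo k; split.
    by rewrite -[X in measurable X]setTI; apply: munc => //; exact: measurableX.
  rewrite /= /pushforward -comp_preimage (_ : unc \o cns = id) ?preimage_id.
    by rewrite product_measure1E// lte_mul_pinfty// ge0_fin_numE.
  by apply/funext => p /=; rewrite cnsK.
by exists (as_sigma_finite sf); rewrite /as_sigma_finite /= -IH.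
Qed.

Section density_measure.
Context {disp} {T : measurableType disp} (mu : {measure set T -> \bar R}).
Variable g : T -> \bar R.
Hypotheses (g0 : forall x, (0 <= g x)%E) (mg : measurable_fun [set: T] g).

Definition density_measure (_ : forall x, (0 <= g x)%E)
  (_ : measurable_fun [set: T] g) (A : set T) : \bar R := (\int[mu]_(x in A) g x)%E.

Local Notation dm := (density_measure g0 mg).

Let dm0 : dm set0 = 0%E. Proof. exact: integral_set0. Qed.

Let dm_ge0 A : (0 <= dm A)%E. Proof. exact: integral_ge0. Qed.

Let dm_sigma_additive : semi_sigma_additive dm.
Proof. exact: semi_sigma_additive_nng_induced mg g0. Qed.

HB.instance Definition _ := isMeasure.Build _ _ _ dm dm0 dm_ge0 dm_sigma_additive.

End density_measure.

Section euclidean.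
Context {d : nat}.
Implicit Types x y m : Rd R d.

Lemma enorm_ge0 x : 0 <= enorm x. Proof. exact: sqrtr_ge0. Qed.

Lemma enorm_sqr x : enorm x ^+ 2 = \sum_(i < d) tnth x i ^+ 2.
Proof. by rewrite sqr_sqrtr// sumr_ge0// => i _; exact: sqr_ge0. Qed.

Lemma enorm_vsub_sqr x y :
  enorm (vsub x y) ^+ 2 = \sum_(i < d) (tnth x i - tnth y i) ^+ 2.
Proof. by rewrite enorm_sqr; apply: eq_bigr => i _; rewrite tnth_mktuple. Qed.

Lemma measurable_enorm : measurable_fun setT (@enorm R d).
Proof.
have ms : measurable_fun [set: R] (@Num.sqrt R).
  by apply: continuous_measurable_fun; exact: sqrt_continuous.
apply: (measurableT_comp ms); apply: measurable_sum => i;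
  apply: measurable_funX; exact: measurable_tnth.
Qed.

Lemma measurable_vsub : measurable_fun setT (fun p : Rd R d * Rd R d => vsub p.1 p.2).
Proof.
apply/measurable_fun_tnthP => i.
rewrite (_ : _ \o _ = fun p : Rd R d * Rd R d => tnth p.1 i - tnth p.2 i); last first.
  by apply/funext => p /=; rewrite tnth_mktuple.
apply: measurable_funB.
  exact: (measurableT_comp (measurable_tnth i) measurable_fst).
exact: (measurableT_comp (measurable_tnth i) measurable_snd).
Qed.

Lemma measurable_sqdist :
  measurable_fun setT (fun p : Rd R d * Rd R d => ((enorm (vsub p.1 p.2)) ^+ 2)%:E).
Proof.
apply/measurable_EFinP; apply: measurable_funX.
exact: measurableT_comp measurable_enorm measurable_vsub.
Qed.

Lemma measurable_radial_density (f : R -> R) m c :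
  {within `[0, +oo[, continuous f} -> 0 < c ->
  measurable_fun setT (fun x : Rd R d => (f (enorm (vsub x m) / c))%:E).
Proof.
move=> cf c0; apply/measurable_EFinP.
have mf : measurable_fun (`[0, +oo[%classic : set R) f.
  exact: subspace_continuous_measurable_fun.
apply: (measurable_comp _ _ mf) => //.
- by move=> _ /= [x _ <-]; rewrite in_itv /= andbT divr_ge0 ?enorm_ge0// ltW.
- apply: measurable_funM => //; apply: (measurableT_comp measurable_enorm).
  have mm : measurable_fun setT (fun x : Rd R d => (x, m)) by exact: measurable_fun_pair.
  exact: measurableT_comp measurable_vsub mm.
Qed.

Lemma radial_probability rho m c : @is_generator R d rho -> 0 < c ->
  exists P : probability (Rd R d) R,
    (P : set (Rd R d) -> \bar R) = radial m c rho.
Proof.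
case: rho => [f|] /=; last by move=> _ _; exists (\d_m).
move=> [cf f0 fm] c0; have [/andP[Z0 Zoo] _] := fm m c c0.
have [L LE] := lebesgue_Rd_sigma_finite d; move: Z0 Zoo.
rewrite /radial_mass -LE; set Z := integral _ _ _ => Z0 Zoo.
pose g (x : Rd R d) := (f (enorm (vsub x m) / c))%:E.
have g0 x : (0 <= g x)%E.
  by rewrite lee_fin f0// divr_ge0 ?enorm_ge0// ltW.
have mg : measurable_fun [set: Rd R d] g := measurable_radial_density m cf c0.
have Zn : 0 <= (fine Z)^-1 by rewrite invr_ge0 fine_ge0// ltW.
pose mu := mscale (NngNum Zn) (density_measure L g0 mg).
have mu1 : mu setT = 1%E.
  rewrite /mu /mscale /density_measure -/Z.
  have Zf : Z \is a fin_num by rewrite ge0_fin_numE// ltW.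
  rewrite -[X in (_ * X)%E](fineK Zf) -EFinM mulVf//.
  by rewrite gt_eqF// fine_gt0// Z0 Zoo.
by exists (as_probability mu1).
Qed.

End euclidean.
End measures.

(** * Gluing two couplings along a countable partition *)

Section gluing.
Context {R : realType} {d1 d2 d3 : measure_display}.
Context {T1 : measurableType d1} {T2 : measurableType d2} {T3 : measurableType d3}.
Variables (g12 : probability (T1 * T2)%type R) (g23 : probability (T2 * T3)%type R).
Variable C : (set T2)^nat.
Hypotheses (mC : forall n, measurable (C n)) (tC : trivIset setT C).
Hypothesis UC : \bigcup_n C n = setT.
Hypothesis g12C : forall n, g12 (setT `*` C n) = g23 (C n `*` setT).

Let c n := g23 (C n `*` setT).

Let cell n : set ((T1 * T2) * (T2 * T3)) := (setT `*` C n) `*` (C n `*` setT).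

Let mcell n : measurable (cell n).
Proof. by apply: measurableX; exact: measurableX. Qed.

Let cV_ge0 n : 0 <= (fine (c n))^-1.
Proof. by rewrite invr_ge0 fine_ge0. Qed.

Let piece n : {measure set ((T1 * T2) * (T2 * T3))%type -> \bar R} :=
  mscale (NngNum (cV_ge0 n)) (mrestr (g12 \x g23)%E (mcell n)).

Let pieceX n A D : measurable A -> measurable D ->
  piece n (A `*` D) = ((fine (c n))^-1%:E *
    (g12 (A `&` (setT `*` C n)) * g23 (D `&` (C n `*` setT))))%E.
Proof.
move=> mA mD; transitivity ((fine (c n))^-1%:E * (g12 \x g23) ((A `*` D) `&` cell n))%E => //.
rewrite -setXI product_measure1E//.
  by apply: measurableI => //; exact: measurableX.
by apply: measurableI => //; exact: measurableX.
Qed.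

Let normalize n (x : \bar R) : (0 <= x <= c n)%E ->
  ((fine (c n))^-1%:E * (x * c n))%E = x.
Proof.
have cf : c n \is a fin_num by apply: fin_num_measure; exact: measurableX.
move=> /andP[x0 xc]; have [c0|c0] := eqVneq (c n) 0%E.
  by move: xc x0; rewrite c0 !mule0 => x0 x0'; apply/eqP; rewrite eq_le x0 x0'.
have xf : x \is a fin_num.
  by rewrite (fin_numElt) (lt_le_trans _ x0)//= (le_lt_trans xc)// ltey_eq cf.
rewrite muleC -muleA -(fineK cf) -EFinM divff ?mule1//.
by rewrite fine_eq0.
Qed.

Let sum_cells (disp : measure_display) (X : measurableType disp)
  (P : probability X R) (F : (set X)^nat) A : measurable A ->
  (forall n, measurable (F n)) -> trivIset setT F -> \bigcup_n F n = setT ->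
  (\sum_(0 <= n <oo) P (A `&` F n))%E = P A.
Proof.
move=> mA mF tF UF; rewrite -[in RHS](setIT A) -UF setI_bigcupr.
rewrite measure_semi_bigcup//.
- by move=> n; exact: measurableI.
- exact: trivIset_setIl.
- by apply: bigcup_measurable => n _; exact: measurableI.
Qed.

(** The measure S |-> sum_n (g12 x g23)(S inter cell n) / nu(C n), where nu is the
common middle marginal: given the cell of the middle coordinate, the two pairs
are independent.  The marginals come out right because the factor nu(C n)
cancels; when nu(C n) = 0 the term vanishes, and so does the share of g12 or
g23 in that cell. *)
Lemma exists_gluing : exists G : probability ((T1 * T2) * (T2 * T3))%type R,
  [/\ forall A, measurable A -> G (A `*` setT) = g12 A,
      forall D, measurable D -> G (setT `*` D) = g23 D
    & forall S, measurable S ->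
        (forall n, S `&` ((setT `*` C n) `*` (C n `*` setT)) = set0) -> G S = 0%E].
Proof.
pose M := mseries piece 0.
have Ml A : measurable A -> M (A `*` setT) = g12 A.
  move=> mA; rewrite -(@sum_cells _ _ g12 (fun n => setT `*` C n) A) //.
  - apply: eq_eseriesr => n _; rewrite pieceX// setTI -/(c n) normalize//.
    rewrite measure_ge0 /c -g12C le_measure ?inE//.
      by apply: measurableI => //; exact: measurableX.
    exact: measurableX.
  - by move=> n; exact: measurableX.
  - by apply/trivIsetP => i j _ _ ij; rewrite -setXI (trivIsetP.1 tC)// setX0.
  - by rewrite -setX_bigcupr UC setXTT.
have Mr D : measurable D -> M (setT `*` D) = g23 D.
  move=> mD; rewrite -(@sum_cells _ _ g23 (fun n => C n `*` setT) D) //.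
  - apply: eq_eseriesr => n _; rewrite pieceX// setTI g12C -/(c n) (muleC (c n)) normalize//.
    rewrite measure_ge0 /c le_measure ?inE//.
      by apply: measurableI => //; exact: measurableX.
    exact: measurableX.
  - by move=> n; exact: measurableX.
  - by apply/trivIsetP => i j _ _ ij; rewrite -setXI (trivIsetP.1 tC)// set0X.
  - by rewrite -setX_bigcupl UC setXTT.
have M1 : M setT = 1%E by rewrite -setXTT Ml// probability_setT.
exists (as_probability M1); split => // S mS S0.
rewrite /as_probability /= /M /mseries eseries0// => n _ _.
have -> : piece n S = ((fine (c n))^-1%:E * (g12 \x g23) (S `&` cell n))%E by [].
by rewrite /cell S0 measure0 mule0.
Qed.

End gluing.

(** * Image measures and small cells *)

Section image_probability.
Context {R : realType} {d1 d2 : measure_display}.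
Context {T1 : measurableType d1} {T2 : measurableType d2}.
Implicit Types P : probability T1 R.

Definition image_probability P (f : T1 -> T2) (mf : measurable_fun setT f) :
    probability T2 R :=
  let F : {mfun T1 >-> T2} := HB.pack f (isMeasurableFun.Build _ _ _ _ f mf) in
  distribution P F.

Lemma image_probabilityE P (f : T1 -> T2) (mf : measurable_fun setT f) A :
  image_probability P mf A = P (f @^-1` A).
Proof. by []. Qed.

Lemma integral_image_probability P f (mf : measurable_fun setT f) (Q : probability T2 R)
    (g : T2 -> \bar R) :
  (forall A, measurable A -> P (f @^-1` A) = Q A) ->
  measurable_fun setT g -> (forall y, (0 <= g y)%E) ->
  (\int[P]_x g (f x) = \int[Q]_y g y)%E.
Proof.
move=> PQ mg g0.
transitivity (\int[image_probability P mf]_y g y)%E; last by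
  apply: eq_measure_integral => A mA _; exact: PQ.
by rewrite ge0_integral_pushforward// => y _; exact: g0.
Qed.

End image_probability.

Section cells.
Context {R : realType} {d : nat}.

(** Cubes of side e / (d + 1), numbered through the countable type of their integer
corners. *)
Lemma small_cells (e : R) : 0 < e -> exists C : (set (Rd R d))^nat,
  [/\ forall n, measurable (C n), trivIset setT C, \bigcup_n C n = setT
    & forall n x y, C n x -> C n y -> enorm (vsub x y) ^+ 2 <= e ^+ 2].
Proof.
move=> e0; pose s := e / d.+1%:R.
have s0 : 0 < s by rewrite divr_gt0.
pose code (x : Rd R d) := [tuple Num.floor (tnth x i / s) | i < d].
have codeP x i z : Num.floor (tnth x i / s) = z <-> (s * z%:~R <= tnth x i < s * (z + 1)%:~R).
  have -> : (s * z%:~R <= tnth x i < s * (z + 1)%:~R) = (z%:~R <= tnth x i / s < (z + 1)%:~R).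
    by rewrite ler_pdivlMr// ltr_pdivrMr// ![s * _]mulrC.
  by split=> [<-|]; [exact: floor_itv|exact: floor_def].
exists (fun n => [set x | pickle (code x) = n]); split.
- move=> n; have [[t tn]|nt] := pselect (exists t : d.-tuple int, pickle t = n).
    have -> : [set x | pickle (code x) = n] = \bigcap_(i : 'I_d)
       ((@tnth _ R ^~ i) @^-1` [set` `[s * (tnth t i)%:~R, s * (tnth t i + 1)%:~R[]).
      apply/seteqP; split=> x /=.
        rewrite -tn => /(pcan_inj pickleK) xt i _ /=.
        by rewrite in_itv /=; apply/codeP; rewrite -xt tnth_mktuple.
      move=> xt; rewrite -tn; congr pickle; apply: eq_from_tnth => i.
      by rewrite tnth_mktuple; apply/codeP; have := xt i I; rewrite /= in_itv.
    apply: fin_bigcap_measurable => // i _.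
    by rewrite -[X in measurable X]setTI; exact: measurable_tnth.
  rewrite (_ : mkset _ = set0)//; apply/seteqP; split=> // x xn.
  by apply: nt; exists (code x).
- apply/trivIsetP => i j _ _ /eqP ij; apply/seteqP; split=> // x [/= xi xj].
  by apply: ij; rewrite -xi -xj.
- by apply/seteqP; split=> // x _; exists (pickle (code x)).
- move=> n x y xn yn.
  have /(pcan_inj pickleK) cxy : pickle (code x) = pickle (code y) by rewrite xn yn.
  rewrite enorm_vsub_sqr.
  apply: (@le_trans _ _ (\sum_(i < d) s ^+ 2)).
    apply: ler_sum => i _; rewrite -ler_sqrt ?sqr_ge0// !sqrtr_sqr (gtr0_norm s0).
    have cxi : Num.floor (tnth x i / s) = Num.floor (tnth y i / s).
      by have := congr1 (@tnth _ _ ^~ i) cxy; rewrite !tnth_mktuple.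
    have /codeP := cxi; have /codeP := erefl (Num.floor (tnth y i / s)).
    rewrite intrD mulrDr mulr1 => /andP[? ?] /andP[? ?].
    by rewrite ler_norml; apply/andP; split; lra.
  rewrite sumr_const card_ord -mulr_natl /s expr_div_n mulrCA.
  rewrite ger_pMr ?exprn_gt0// ler_pdivrMr ?exprn_gt0 ?ltr0n// mul1r -natrX ler_nat.
  by rewrite (leq_trans (leqnSn d))// expnS expn1 leq_pmulr.
Qed.

End cells.

(** * Couplings and the quadratic Wasserstein distance *)

Section w2.
Context {R : realType} {d : nat}.
Implicit Types (mu nu xi : set (Rd R d) -> \bar R).
Implicit Types gamma : probability (Rd R d * Rd R d)%type R.

Definition in_P2 mu := exists P : probability (Rd R d) R,
  (P : set (Rd R d) -> \bar R) = mu /\ (second_moment mu < +oo)%E.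

Definition sqdist (p : Rd R d * Rd R d) : \bar R := (enorm (vsub p.1 p.2) ^+ 2)%:E.

Definition quadratic_cost gamma : \bar R := (\int[gamma]_p sqdist p)%E.

Lemma sqdist_ge0 p : (0 <= sqdist p)%E.
Proof. by rewrite lee_fin sqr_ge0. Qed.

Lemma quadratic_cost_ge0 gamma : (0 <= quadratic_cost gamma)%E.
Proof. by apply: integral_ge0 => p _; exact: sqdist_ge0. Qed.

Lemma W2_ge0 mu nu : 0 <= W2 mu nu.
Proof. exact: sqrtr_ge0. Qed.

Lemma inf_cost_ge0 mu nu :
  (0 <= ereal_inf [set quadratic_cost gamma | gamma in coupling mu nu])%E.
Proof. by apply: le_ereal_inf_tmp => _ [g _ <-]; exact: quadratic_cost_ge0. Qed.

(** The bound on the cost keeps the infimum finite, so [fine] returns it unchanged. *)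
Lemma W2_le_coupling mu nu gamma e : coupling mu nu gamma -> 0 <= e ->
  (quadratic_cost gamma <= (e ^+ 2)%:E)%E -> W2 mu nu <= e.
Proof.
move=> cg e0 ce; rewrite -[e]ger0_norm// -sqrtr_sqr /W2 ler_sqrt ?sqr_ge0//.
have le_inf : (ereal_inf [set quadratic_cost gamma | gamma in coupling mu nu]
    <= (e ^+ 2)%:E)%E.
  by apply: le_trans ce; apply: ereal_inf_lbound; exists gamma.
rewrite -lee_fin fineK// ge0_fin_numE ?inf_cost_ge0//.
exact: le_lt_trans le_inf (ltry _).
Qed.

Lemma integral_coupling_fst mu nu gamma (P : probability (Rd R d) R) (f : Rd R d -> \bar R) :
  (P : set (Rd R d) -> \bar R) = mu -> coupling mu nu gamma ->
  measurable_fun setT f -> (forall x, (0 <= f x)%E) ->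
  (\int[gamma]_p f p.1 = \int[mu]_x f x)%E.
Proof.
move=> <- [g1 _] mf f0; apply: (integral_image_probability measurable_fst) => // A mA.
by rewrite -setXT g1.
Qed.

Lemma coupling_swap mu nu gamma : coupling mu nu gamma ->
  exists2 gamma', coupling nu mu gamma' & quadratic_cost gamma' = quadratic_cost gamma.
Proof.
move=> [g1 g2].
have msw : measurable_fun setT (fun p : Rd R d * Rd R d => (p.2, p.1)).
  by apply: measurable_fun_pair; [exact: measurable_snd|exact: measurable_fst].
exists (image_probability gamma msw).
  split=> A mA; rewrite image_probabilityE; [rewrite -g2//|rewrite -g1//];
  by congr (gamma _); apply/seteqP; split=> -[x y] /= [].
rewrite /quadratic_cost -(@integral_image_probability _ _ _ _ _ gamma _ msw _ sqdist)//.
- apply: eq_integral => p _; rewrite /sqdist !enorm_vsub_sqr; congr _%:E.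
  by apply: eq_bigr => i _; rewrite -sqrrN opprB.
- exact: measurable_sqdist.
- exact: sqdist_ge0.
Qed.

Lemma W2_sym mu nu : W2 mu nu = W2 nu mu.
Proof.
rewrite /W2; congr (Num.sqrt (fine (ereal_inf _))).
suff sub mu' nu' : [set quadratic_cost gamma | gamma in coupling mu' nu'] `<=`
    [set quadratic_cost gamma | gamma in coupling nu' mu'].
  by apply/seteqP; split; exact: sub.
by move=> _ [g /coupling_swap[g' cg' <-] <-]; exists g'.
Qed.

Lemma W2_meas_eq mu nu : in_P2 mu -> meas_eq mu nu -> W2 mu nu = 0.
Proof.
move=> [P [<- _]] mn.
have mdiag : measurable_fun setT (fun x : Rd R d => (x, x)).
  by apply: measurable_fun_pair; exact: measurable_id.
apply/eqP; rewrite eq_le W2_ge0 andbT.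
apply: (@W2_le_coupling _ _ (image_probability P mdiag)) => //.
  split=> A mA; rewrite image_probabilityE; last rewrite -mn//;
  by congr (P _); apply/seteqP; split=> x //= [].
rewrite /quadratic_cost -(@integral_image_probability _ _ _ _ _ P _ mdiag _ sqdist)//.
- rewrite integral0_eq ?expr0n// => x _; rewrite /sqdist enorm_vsub_sqr big1// => i _.
  by rewrite subrr expr0n.
- exact: measurable_sqdist.
- exact: sqdist_ge0.
Qed.

Lemma measurable_sqnorm : measurable_fun setT (fun x : Rd R d => (enorm x ^+ 2)%:E).
Proof. by apply/measurable_EFinP; apply: measurable_funX; exact: measurable_enorm. Qed.

(** The product coupling works, since |x - y|^2 <= 2 (|x|^2 + |y|^2).  It guarantees
that W2 is the root of a finite infimum rather than of the default value that
[fine] gives to +oo. *)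
Lemma finite_coupling mu nu : in_P2 mu -> in_P2 nu ->
  exists2 gamma, coupling mu nu gamma & (quadratic_cost gamma < +oo)%E.
Proof.
move=> [P [Pmu mu2]] [Q [Qnu nu2]].
pose g : probability (Rd R d * Rd R d)%type R := (P \x Q)%E.
have cg : coupling mu nu g.
  split=> A mA; rewrite /= product_measure1E//.
    by rewrite -Pmu -[RHS]mule1; congr (_ * _)%E; exact: probability_setT.
  by rewrite -Qnu -[RHS]mul1e; congr (_ * _)%E; exact: probability_setT.
exists g => //.
have msn1 : measurable_fun setT (fun p : Rd R d * Rd R d => (enorm p.1 ^+ 2)%:E).
  exact: (measurableT_comp measurable_sqnorm measurable_fst).
have msn2 : measurable_fun setT (fun p : Rd R d * Rd R d => (enorm p.2 ^+ 2)%:E).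
  exact: (measurableT_comp measurable_sqnorm measurable_snd).
have sqr0 (x : Rd R d) : (0 <= (enorm x ^+ 2)%:E)%E by rewrite lee_fin sqr_ge0.
apply: (@le_lt_trans _ _ (\int[g]_p (2%:E * ((enorm p.1 ^+ 2)%:E + (enorm p.2 ^+ 2)%:E)))%E).
  apply: ge0_le_integral => //.
  - by move=> p _; exact: sqdist_ge0.
  - exact: measurable_sqdist.
  - by apply: measurable_funeM; exact: emeasurable_funD.
  - move=> p _; rewrite lee_fin !enorm_sqr -big_split mulr_sumr /=; apply: ler_sum => i _.
    rewrite tnth_mktuple; set a := tnth _ _; set b := tnth _ _.
    rewrite -subr_ge0 (_ : _ - _ = (a + b) ^+ 2) ?sqr_ge0//; ring.
rewrite ge0_integralZl//; last 2 first.
  - exact: emeasurable_funD.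
  - by move=> p _; rewrite adde_ge0.
rewrite ge0_integralD//.
rewrite (integral_coupling_fst Pmu cg measurable_sqnorm)//.
rewrite (@integral_image_probability _ _ _ _ _ g _ measurable_snd Q
   (fun x : Rd R d => (enorm x ^+ 2)%:E)) //.
- by rewrite Qnu lte_mul_pinfty// lte_add_pinfty.
- by move=> A mA; rewrite -setTX (cg.2 A mA) Qnu.
- exact: measurable_sqnorm.
Qed.

Lemma coupling_lt mu nu e : in_P2 mu -> in_P2 nu -> W2 mu nu < e ->
  exists2 gamma, coupling mu nu gamma & (quadratic_cost gamma < (e ^+ 2)%:E)%E.
Proof.
move=> Pmu Pnu We.
have e0 : 0 < e := le_lt_trans (W2_ge0 mu nu) We.
have inf_lt : (ereal_inf [set quadratic_cost gamma | gamma in coupling mu nu] < (e ^+ 2)%:E)%E.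
  have [g cg goo] := finite_coupling Pmu Pnu.
  rewrite -[X in (X < _)%E]fineK.
    rewrite lte_fin ltNge; apply/negP => le; move: We; apply/negP; rewrite -leNgt.
    by rewrite -[e]gtr0_norm// -sqrtr_sqr; apply: ler_wsqrtr.
  rewrite ge0_fin_numE ?inf_cost_ge0//; apply: le_lt_trans goo.
  by apply: ereal_inf_lbound; exists g.
by have [_ [g cg <-] ge] := ereal_inf_lt inf_lt; exists g.
Qed.

End w2.

(** * The triangle inequality for W2 *)

Section w2_triangle.
Context {R : realType} {d : nat}.
Implicit Types (mu nu xi : set (Rd R d) -> \bar R).

(** The weighted square inequality holds coordinate by coordinate, so it passes to
Euclidean norms without Minkowski's inequality. *)
Lemma sqdist_glue_le (s t u : R) (x y y' z : Rd R d) : 0 < s -> 0 < t -> 0 < u ->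
  (sqdist (x, z) <= (s + t + u)%:E *
     (s^-1%:E * sqdist (x, y) + (t^-1%:E * sqdist (y, y') + u^-1%:E * sqdist (y', z))))%E.
Proof.
move=> s0 t0 u0; rewrite /sqdist -[leRHS]/(EFin _) lee_fin /= !enorm_vsub_sqr.
rewrite !mulr_sumr -!big_split mulr_sumr /=; apply: ler_sum => i _.
have -> : tnth x i - tnth z i =
    (tnth x i - tnth y i) + (tnth y i - tnth y' i) + (tnth y' i - tnth z i) by ring.
apply: (le_trans (sqr_add3_le _ _ _ s0 t0 u0)).
by rewrite ![_ / _]mulrC addrA.
Qed.

(** For the coupling of x and z read off the glued measure, |y - y'| <= e holds almost
surely.  With the weights s, e, t the integrated bound is
(s + e + t) (s^2/s + e^2/e + t^2/t) = (s + e + t)^2. *)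
Lemma glue_cost_le mu nu xi (g12 g23 : probability (Rd R d * Rd R d)%type R) s t e :
  coupling mu nu g12 -> coupling nu xi g23 -> 0 < s -> 0 < t -> 0 < e ->
  (quadratic_cost g12 <= (s ^+ 2)%:E)%E -> (quadratic_cost g23 <= (t ^+ 2)%:E)%E ->
  W2 mu xi <= s + e + t.
Proof.
move=> [g121 g122] [g231 g232] s0 t0 e0 c12 c23.
have [C [mC tC UC Ce]] := @small_cells R d e e0.
have gC n : g12 (setT `*` C n) = g23 (C n `*` setT) by rewrite g122// g231.
have [G [G1 G2 G0]] := exists_gluing mC tC UC gC.
have mfst := @measurable_fst _ _ (Rd R d) (Rd R d).
have msnd := @measurable_snd _ _ (Rd R d) (Rd R d).
have mF := @measurable_fst _ _ (Rd R d * Rd R d)%type (Rd R d * Rd R d)%type.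
have mS := @measurable_snd _ _ (Rd R d * Rd R d)%type (Rd R d * Rd R d)%type.
have mout : measurable_fun setT
    (fun q : (Rd R d * Rd R d) * (Rd R d * Rd R d) => (q.1.1, q.2.2)).
  apply: measurable_fun_pair; first exact: (measurableT_comp mfst mF).
  exact: (measurableT_comp msnd mS).
have mmid : measurable_fun setT
    (fun q : (Rd R d * Rd R d) * (Rd R d * Rd R d) => (q.1.2, q.2.1)).
  apply: measurable_fun_pair; first exact: (measurableT_comp msnd mF).
  exact: (measurableT_comp mfst mS).
have msq : measurable_fun setT (@sqdist R d) by exact: measurable_sqdist.
have m1 := measurableT_comp msq mF.
have m2 := measurableT_comp msq mS.
have m3 := measurableT_comp msq mmid.
have sq0 : forall p, (0 <= @sqdist R d p)%E by exact: sqdist_ge0.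
apply: (@W2_le_coupling _ _ _ _ (image_probability G mout)).
- split=> A mA; rewrite image_probabilityE.
    rewrite -g121// -G1; last exact: measurableX.
    by congr (G _); apply/seteqP; split=> -[[x y] [y' z]] /= [].
  rewrite -g232// -G2; last exact: measurableX.
  by congr (G _); apply/seteqP; split=> -[[x y] [y' z]] /= [] // [].
- by rewrite addr_ge0 ?addr_ge0// ltW.
rewrite /quadratic_cost -(@integral_image_probability _ _ _ _ _ G _ mout _ sqdist)//.
have scale (r : R) c : 0 < r -> (c <= (r ^+ 2)%:E)%E -> (r^-1%:E * c <= r%:E)%E.
  move=> r0 cr; apply: (@le_trans _ _ (r^-1%:E * (r ^+ 2)%:E)%E).
    by rewrite lee_wpmul2l// lee_fin invr_ge0 ltW.
  by rewrite -EFinM expr2 mulrA mulVf ?mul1r// gt_eqF.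
pose bnd (q : (Rd R d * Rd R d) * (Rd R d * Rd R d)) : \bar R :=
  ((s + e + t)%:E * (s^-1%:E * sqdist q.1 + (e%:E + t^-1%:E * sqdist q.2)))%E.
have sE : (0 <= s^-1%:E)%E by rewrite lee_fin invr_ge0 ltW.
have tE : (0 <= t^-1%:E)%E by rewrite lee_fin invr_ge0 ltW.
have eE : (0 <= e%:E)%E by rewrite lee_fin ltW.
have setE : (0 <= (s + e + t)%:E)%E by rewrite lee_fin !addr_ge0// ltW.
have m0 := measurableT_comp msq mout.
have m1' := measurable_funeM s^-1%:E m1.
have m2' := measurable_funeM t^-1%:E m2.
have m2'' : measurable_fun setT (fun q : (Rd R d * Rd R d) * (Rd R d * Rd R d) =>
    (e%:E + t^-1%:E * sqdist q.2)%E) by apply: emeasurable_funD.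
have m12 := emeasurable_funD m1' m2''.
apply: (@le_trans _ _ (\int[G]_q bnd q)%E).
  apply: ae_ge0_le_integral => //.
  - by move=> q _; rewrite /bnd mule_ge0// adde_ge0 ?mule_ge0// adde_ge0// mule_ge0.
  - by apply: measurable_funeM.
  - (* No two points of one cell are that far apart, so S is a null set. *)
    pose S := [set q : (Rd R d * Rd R d) * (Rd R d * Rd R d) |
      ((e ^+ 2)%:E < sqdist (q.1.2, q.2.1))%E].
    have mSS : measurable S.
      rewrite -[S]setTI; exact: (emeasurable_fun_o_infty measurableT m3).
    exists S; split=> //.
      apply: G0 => // n; apply/seteqP; split=> // -[[x y] [y' z]] [/= Sq [[_ Cy] [Cy' _]]].
      by move: Sq; apply/negP; rewrite -leNgt lee_fin; exact: Ce Cy Cy'.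
    move=> [[x y] [y' z]] /= nle; rewrite /S /= ltNge; apply/negP => le; apply: nle => _.
    apply: (le_trans (@sqdist_glue_le s e t x y y' z s0 e0 t0)).
    rewrite /bnd /= lee_wpmul2l// leeD2l// leeD2r//.
    exact: scale.
rewrite /bnd ge0_integralZl//; last first.
  by move=> q _; rewrite adde_ge0 ?mule_ge0// adde_ge0// mule_ge0.
rewrite ge0_integralD//; last 2 first.
- by move=> q _; rewrite mule_ge0.
- by move=> q _; rewrite adde_ge0// mule_ge0.
rewrite [X in (_ * (_ + X) <= _)%E]ge0_integralD//; last first.
  by move=> q _; rewrite mule_ge0.
rewrite !ge0_integralZl// integral_cst//.
rewrite [X in (e%:E * X)%E](_ : _ = 1%E) ?mule1; last exact: (probability_setT G).
rewrite (@integral_image_probability _ _ _ _ _ G _ mF g12)//; last first.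
  by move=> A mA; rewrite -setXT G1.
rewrite (@integral_image_probability _ _ _ _ _ G _ mS g23)//; last first.
  by move=> A mA; rewrite -setTX G2.
rewrite expr2 EFinM lee_wpmul2l// -addrA !EFinD.
by rewrite leeD ?leeD2l ?scale.
Qed.

Lemma W2_triangle mu nu xi : in_P2 mu -> in_P2 nu -> in_P2 xi ->
  W2 mu xi <= W2 mu nu + W2 nu xi.
Proof.
move=> Pmu Pnu Pxi; apply: le_add_of_gt => s t Ws Wt.
have [g12 c12 /ltW l12] := coupling_lt Pmu Pnu Ws.
have [g23 c23 /ltW l23] := coupling_lt Pnu Pxi Wt.
have s0 : 0 < s := le_lt_trans (W2_ge0 _ _) Ws.
have t0 : 0 < t := le_lt_trans (W2_ge0 _ _) Wt.
apply/ler_addgt0Pr => e e0; rewrite addrAC.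
exact: glue_cost_le c12 c23 s0 t0 e0 l12 l23.
Qed.

End w2_triangle.

(** * Measures at W2-distance zero are equal *)

Section w2_separated.
Context {R : realType} {d : nat}.
Implicit Types (mu nu xi : set (Rd R d) -> \bar R) (P Q : probability (Rd R d) R).

(** Open boxes are stable under intersection and exhausted from inside by smaller
ones; this is what allows comparing measures on them. *)
Definition obox (a : 'I_d -> R) : set (Rd R d) := [set x | forall i, tnth x i < a i].

Lemma oboxE a : obox a = \bigcap_(i : 'I_d) ((@tnth _ R ^~ i) @^-1` `]-oo, a i[).
Proof.
apply/seteqP; split=> x xa i; first by move=> _; rewrite /= in_itv /= xa.
by have := xa i I; rewrite /= in_itv.
Qed.

Lemma measurable_obox a : measurable (obox a).
Proof.
rewrite oboxE; apply: fin_bigcap_measurable => // i _.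
by rewrite -[X in measurable X]setTI; exact: measurable_tnth.
Qed.

Lemma oboxI a b : obox a `&` obox b = obox (fun i => Num.min (a i) (b i)).
Proof.
apply/seteqP; split=> [x [xa xb] i|x xab]; first by rewrite lt_min xa xb.
by split=> i; have := xab i; rewrite lt_min => /andP[].
Qed.

Lemma exists_nat_gt (x : R) : exists n : nat, x < n%:R.
Proof. by exists (Num.trunc x).+1; exact: truncnS_gt. Qed.

Lemma exists_nat_bound (x : Rd R d) (a : nat -> 'I_d -> R) :
  (forall i m n, (m <= n)%N -> a m i <= a n i) ->
  (forall i, exists n, tnth x i < a n i) -> exists n, obox (a n) x.
Proof.
move=> nda /choice[f xf]; exists (\max_i f i)%N => i.
by apply: lt_le_trans (xf i) _; apply: nda; exact: leq_bigmax.
Qed.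

Lemma bigcup_obox : \bigcup_n obox (fun=> n%:R) = [set: Rd R d].
Proof.
apply/seteqP; split=> // x _.
have [|i|n xn] := @exists_nat_bound x (fun n _ => n%:R); last by exists n.
  by move=> _ m n mn; rewrite ler_nat.
exact: exists_nat_gt.
Qed.

(** A half-space x_i < r is the increasing union of the boxes whose other sides
tend to +oo. *)
Lemma measurable_generated_obox : @measurable _ (Rd R d) = <<s range obox >>.
Proof.
apply/seteqP; split; last first.
  apply: smallest_sub; first exact: sigma_algebra_measurable.
  by move=> _ [a _ <-]; exact: measurable_obox.
apply: smallest_sub; first exact: smallest_sigma_algebra.
suff mt i : preimage_set_system setT (@tnth d R ^~ i) measurable `<=` <<s range obox >>.
  by rewrite -bigcup_seq; apply: bigcup_sub => i _; exact: mt.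
have := @measurability _ _ (g_sigma_algebraType (range obox)) (measurableTypeR R) setT
  (@tnth d R ^~ i) _ (RGenInftyO.measurableE R).
move=> mt _ [B mB <-]; apply: mt => // _ [_ [r ->] <-].
pose a n j := if j == i then r else n%:R.
have -> : [set: Rd R d] `&` (@tnth d R ^~ i) @^-1` `]-oo, r[ = \bigcup_n obox (a n).
  rewrite setTI; apply/seteqP; split=> x /=.
    rewrite in_itv /= => xr; have [|j|n xn] := @exists_nat_bound x a; last by exists n.
      by move=> j m n mn; rewrite /a; case: ifP => // _; rewrite ler_nat.
    rewrite /a; case: eqVneq => [->|_]; first by exists 0.
    exact: exists_nat_gt.
  by move=> [n _ /(_ i)]; rewrite /a eqxx in_itv.
apply: bigcup_measurable => n _; apply: sub_sigma_algebra; by exists (a n).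
Qed.

Lemma probability_eq_obox P Q : (forall a, P (obox a) = Q (obox a)) ->
  meas_eq P Q.
Proof.
move=> PQ A mA; apply: (measure_unique (range obox) (fun n => obox (fun=> n%:R))) => //.
- exact: measurable_generated_obox.
- by move=> _ _ [a _ <-] [b _ <-]; rewrite oboxI; eexists.
- exact: bigcup_obox.
- by move=> _ [a _ <-]; exact: PQ.
- by move=> n; rewrite -ge0_fin_numE ?measure_ge0// fin_num_measure//; exact: measurable_obox.
Qed.

(** If x lies in the box shrunk by r and y is outside the box, then |x - y| >= r,
which has probability at most cost / r^2 by Markov's inequality. *)
Lemma coupling_obox_le P Q gamma (a : 'I_d -> R) (r : R) : coupling P Q gamma -> 0 < r ->
  (P (obox (fun i => (a i - r)%R)) <= Q (obox a) + (r ^+ 2)^-1%:E * quadratic_cost gamma)%E.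
Proof.
move=> [g1 g2] r0.
pose far := [set p : Rd R d * Rd R d | ((r ^+ 2)%:E <= sqdist p)%E].
have msq : measurable_fun setT (@sqdist R d) by exact: measurable_sqdist.
have mfar : measurable far.
  by rewrite -[far]setTI; exact: (emeasurable_fun_c_infty measurableT msq).
have r20 : 0 < r ^+ 2 by rewrite exprn_gt0.
have far_le : (gamma far <= (r ^+ 2)^-1%:E * quadratic_cost gamma)%E.
  rewrite -[leLHS]mul1e -(mulVf (lt0r_neq0 r20)) EFinM -muleA lee_wpmul2l//.
    by rewrite lee_fin invr_ge0 ltW.
  rewrite -integral_cst//.
  apply: (@le_trans _ _ (\int[gamma]_(p in far) sqdist p)%E).
    apply: ge0_le_integral => //.
      by move=> p _ /=; rewrite lee_fin ltW.
    exact: measurable_funTS.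
  by apply: ge0_subset_integral => // p _; exact: sqdist_ge0.
rewrite -g1; last exact: measurable_obox.
rewrite -g2; last exact: measurable_obox.
have mX : measurable (obox (fun i => a i - r) `*` [set: Rd R d]).
  by apply: measurableX => //; exact: measurable_obox.
have mY : measurable ([set: Rd R d] `*` obox a).
  by apply: measurableX => //; exact: measurable_obox.
apply: (@le_trans _ _ (gamma (([set: Rd R d] `*` obox a) `|` far))); last first.
  by apply: (le_trans (measureU2 _ _ _)) => //; rewrite leeD2l.
apply: le_measure; rewrite ?inE//; first exact: measurableU.
move=> [x y] [/= xa _]; have [[i yi]|ny] := pselect (exists i, a i <= tnth y i); last first.
  left; split=> // i; rewrite ltNge; apply/negP => yi; apply: ny; by exists i.
right; rewrite /far /= lee_fin /= enorm_vsub_sqr (bigD1 i)//=.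
apply: (@le_trans _ _ ((tnth x i - tnth y i) ^+ 2)).
  rewrite -[leRHS]sqrrN opprB; apply: lerXn2r; rewrite ?nnegrE; have := xa i; lra.
by rewrite lerDl sumr_ge0// => j _; exact: sqr_ge0.
Qed.

Lemma bigcup_shrunk_obox (a : 'I_d -> R) :
  \bigcup_n obox (fun i => a i - n.+1%:R^-1) = obox a.
Proof.
apply/seteqP; split=> [x [n _ xn] i|x xa].
  by apply: lt_le_trans (xn i) _; rewrite lerBlDr lerDl.
have [|i|n xn] := @exists_nat_bound x (fun n i => a i - n.+1%:R^-1); last by exists n.
  by move=> i m n mn; rewrite lerB// lef_pV2 ?posrE// ler_nat.
have xai : 0 < a i - tnth x i by rewrite subr_gt0 xa.
have [n nb] := exists_nat_gt (a i - tnth x i)^-1; exists n.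
rewrite ltrBrDl -ltrBrDr invf_plt ?posrE//; apply: lt_trans nb _.
by rewrite ltr_nat.
Qed.

(** Couplings of arbitrarily small cost give P(box shrunk by r) <= Q(box) for every
r > 0, hence P(box) <= Q(box) by continuity from below; W2 is symmetric. *)
Lemma W2_eq0 mu nu : in_P2 mu -> in_P2 nu -> W2 mu nu = 0 -> meas_eq mu nu.
Proof.
move=> Pmu Pnu W0; have [P [PE _]] := Pmu; have [Q [QE _]] := Pnu.
suff le P' Q' (mu' nu' : set (Rd R d) -> \bar R) (a : 'I_d -> R) :
    in_P2 mu' -> in_P2 nu' -> W2 mu' nu' = 0 ->
    (P' : probability (Rd R d) R) = mu' :> (set _ -> _) ->
    (Q' : probability (Rd R d) R) = nu' :> (set _ -> _) -> (P' (obox a) <= Q' (obox a))%E.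
  move=> A mA; rewrite -PE -QE; apply: probability_eq_obox => // a.
  apply/eqP; rewrite eq_le (le P Q mu nu)//= (le Q P nu mu)//.
  by rewrite W2_sym.
move=> Pmu' Pnu' W0' PE' QE'.
have shrunk_le (r : R) : 0 < r -> (P' (obox (fun i => (a i - r)%R)) <= Q' (obox a))%E.
  move=> r0; apply/lee_addgt0Pr => e e0.
  (* Markov's inequality at distance r turns a cost of s^2 = r^2 e into e. *)
  pose s := r * Num.sqrt e.
  have s0 : 0 < s by rewrite mulr_gt0// sqrtr_gt0.
  have [|g cg /ltW gs] := @coupling_lt _ _ mu' nu' s Pmu' Pnu'; first by rewrite W0'.
  rewrite -PE' -QE' in cg.
  apply: (le_trans (coupling_obox_le a cg r0)); rewrite leeD2l//.
  apply: (@le_trans _ _ ((r ^+ 2)^-1%:E * (s ^+ 2)%:E)%E).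
    by rewrite lee_wpmul2l// lee_fin invr_ge0 sqr_ge0.
  have r2 : r ^+ 2 != 0 by rewrite expf_neq0// gt_eqF.
  by rewrite -EFinM lee_fin exprMn (sqr_sqrtr (ltW e0)) mulrA mulVf// mul1r.
rewrite -[X in (P' X <= _)%E](bigcup_shrunk_obox a).
pose F n := obox (fun i => a i - n.+1%:R^-1).
have ndF : nondecreasing_seq F.
  move=> m n mn; apply/subsetPset => x xm i; apply: lt_le_trans (xm i) _.
  by rewrite lerB// lef_pV2 ?posrE// ler_nat.
have mF n : measurable (F n) := measurable_obox _.
have cv : (P' \o F) n @[n --> \oo] --> P' (\bigcup_n F n).
  by apply: nondecreasing_cvg_mu => //; exact: bigcup_measurable.
rewrite -(cvg_lim _ cv)//.
apply: lime_le; first by apply/cvg_ex; eexists; exact: cv.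
by apply: nearW => n /=; exact: shrunk_le.
Qed.

End w2_separated.

(** * The transport distance between mixtures *)

Section mixture_distance.
Context {R : realType} {d : nat}.
Implicit Types (rho : generator R) (p q : mixture R d).
Implicit Types mu nu : set (Rd R d) -> \bar R.

Lemma meas_eq_sym mu nu : meas_eq mu nu -> meas_eq nu mu.
Proof. by move=> h A mA; rewrite h. Qed.

Lemma meas_eq_trans mu nu xi : meas_eq mu nu -> meas_eq nu xi ->
  @meas_eq _ (Rd R d) R mu xi.
Proof. by move=> h1 h2 A mA; rewrite h1// h2. Qed.

Lemma component_in_P2 rho p k : @is_generator R d rho ->
  in_P2 (component (p := p) rho k).
Proof.
move=> grho; have c0 := scale_gt0 k.
have [P PE] := radial_probability (Defs.center k) grho c0.
exists P; split=> //; rewrite /component.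
case: rho grho {PE} => [f|] /=; first by move=> [_ _ /(_ (Defs.center k) _ c0)[]].
move=> _; rewrite /second_moment integral_dirac//; first by rewrite diracT mul1e ltry.
exact: measurable_sqnorm.
Qed.

Lemma component_fin_num rho p k A : @is_generator R d rho -> measurable A ->
  component (p := p) rho k A \is a fin_num.
Proof.
by move=> /(component_in_P2 k)[P [<- _]] mA; exact: fin_num_measure.
Qed.

(** Components take finite values on measurable sets, so mixtures can be handled
with real sums. *)
Lemma mixture_law_fine rho p A : @is_generator R d rho -> measurable A ->
  mixture_law rho p A = (\sum_k weight k * fine (component (p := p) rho k A))%:E.
Proof.
move=> grho mA; rewrite /mixture_law -sumEFin; apply: eq_bigr => k _.
by rewrite EFinM fineK// component_fin_num.
Qed.

Lemma plan_cost_ge0 rho0 rho1 p q w : transport_plan w ->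
  0 <= plan_cost (p0 := p) (p1 := q) rho0 rho1 w.
Proof.
move=> [w0 _ _]; apply: sumr_ge0 => k _; apply: sumr_ge0 => l _.
by rewrite mulr_ge0 ?sqr_ge0.
Qed.

Definition mixture_distance rho0 rho1 p q : R :=
  Num.sqrt (plan_cost rho0 rho1 (sval (cid (exists_optimal_plan rho0 rho1 p q)))).

Lemma mixture_distance_optimal rho0 rho1 p q (w : 'M[R]_(ncomp p, ncomp q)) :
  optimal_plan rho0 rho1 w ->
  mixture_distance rho0 rho1 p q = Num.sqrt (plan_cost rho0 rho1 w).
Proof.
move=> [pw wmin]; rewrite /mixture_distance; case: cid => /= v [pv vmin].
by congr Num.sqrt; apply/eqP; rewrite eq_le vmin// wmin.
Qed.

Lemma mixture_distance_le rho0 rho1 p q (w : 'M[R]_(ncomp p, ncomp q)) :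
  transport_plan w ->
  mixture_distance rho0 rho1 p q <= Num.sqrt (plan_cost rho0 rho1 w).
Proof.
move=> pw; rewrite /mixture_distance; case: cid => /= v [pv vmin].
by apply: ler_wsqrtr; exact: vmin.
Qed.

Lemma mixture_distance_attained rho0 rho1 p q :
  exists2 w : 'M[R]_(ncomp p, ncomp q), transport_plan w
    & plan_cost rho0 rho1 w = mixture_distance rho0 rho1 p q ^+ 2.
Proof.
rewrite /mixture_distance; case: cid => /= v [pv _].
by exists v; rewrite // sqr_sqrtr// plan_cost_ge0.
Qed.

Lemma mixture_distance_ge0 rho0 rho1 p q : 0 <= mixture_distance rho0 rho1 p q.
Proof. exact: sqrtr_ge0. Qed.

Lemma mixture_distance_sym rho0 rho1 p q :
  mixture_distance rho0 rho1 p q = mixture_distance rho1 rho0 q p.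
Proof.
suff le rho rho' p' q' : mixture_distance rho rho' p' q' <= mixture_distance rho' rho q' p'.
  by apply/eqP; rewrite eq_le !le.
have [w [w0 w1 w2] cw] := mixture_distance_attained rho' rho q' p'.
rewrite -[leRHS]ger0_norm ?mixture_distance_ge0// -sqrtr_sqr -cw.
have -> : plan_cost rho' rho w = plan_cost (p0 := p') (p1 := q') rho rho' w^T.
  rewrite /plan_cost exchange_big; apply: eq_bigr => k _; apply: eq_bigr => l _.
  by rewrite mxE W2_sym.
apply: mixture_distance_le; split=> [k l|k|l]; first by rewrite mxE.
  by rewrite -w2; apply: eq_bigr => l _; rewrite mxE.
by rewrite -w1; apply: eq_bigr => k _; rewrite mxE.
Qed.

(** Gluing of plans: u k l m is the mass that goes from component k through l to m.
When the middle weight vanishes, all the entries of the plans at l vanish too,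
so that dividing by it is harmless. *)
Lemma mixture_distance_triangle rho0 rho1 rho2 p0 p1 p2 :
  @is_generator R d rho0 -> @is_generator R d rho1 -> @is_generator R d rho2 ->
  mixture_distance rho0 rho2 p0 p2 <=
    mixture_distance rho0 rho1 p0 p1 + mixture_distance rho1 rho2 p1 p2.
Proof.
move=> g0 g1 g2.
have [w [w0 wr wc] cw] := mixture_distance_attained rho0 rho1 p0 p1.
have [v [v0 vr vc] cv] := mixture_distance_attained rho1 rho2 p1 p2.
pose u k l m := w k l * v l m / @weight _ _ p1 l.
have u0 k l m : 0 <= u k l m by rewrite divr_ge0 ?weight_ge0// mulr_ge0.
have ur k l : \sum_m u k l m = w k l.
  rewrite /u -mulr_suml -mulr_sumr vr.
  have [pi0|pi0] := eqVneq (@weight _ _ p1 l) 0; last by rewrite mulfK.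
  rewrite pi0 mulr0 mul0r; apply/esym/eqP; rewrite eq_le w0 andbT -pi0 -wc.
  by rewrite (bigD1 k)//= lerDl sumr_ge0.
have uc l m : \sum_k u k l m = v l m.
  rewrite /u -mulr_suml -mulr_suml wc.
  have [pi0|pi0] := eqVneq (@weight _ _ p1 l) 0; last by rewrite mulrC mulKf.
  rewrite pi0 !mul0r; apply/esym/eqP; rewrite eq_le v0 andbT -pi0 -vr.
  by rewrite (bigD1 m)//= lerDl sumr_ge0.
have pwv : transport_plan (p0 := p0) (p1 := p2) (\matrix_(k, m) \sum_l u k l m).
  split=> [k m|k|m]; first by rewrite mxE sumr_ge0.
    under eq_bigr do rewrite mxE; rewrite exchange_big -wr.
    by apply: eq_bigr => l _; exact: ur.
  under eq_bigr do rewrite mxE; rewrite exchange_big -vc.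
  by apply: eq_bigr => l _; exact: uc.
apply: le_add_of_gt => s t As Bt.
have s0 : 0 < s := le_lt_trans (mixture_distance_ge0 _ _ _ _) As.
have t0 : 0 < t := le_lt_trans (mixture_distance_ge0 _ _ _ _) Bt.
apply: (le_trans (mixture_distance_le rho0 rho2 pwv)).
have st0 : 0 <= s + t by rewrite addr_ge0// ltW.
rewrite -[leRHS]ger0_norm// -sqrtr_sqr; apply: ler_wsqrtr.
have ds : mixture_distance rho0 rho1 p0 p1 ^+ 2 <= s ^+ 2.
  by rewrite lerXn2r ?nnegrE ?mixture_distance_ge0// ltW.
have dt : mixture_distance rho1 rho2 p1 p2 ^+ 2 <= t ^+ 2.
  by rewrite lerXn2r ?nnegrE ?mixture_distance_ge0// ltW.
pose D k l := W2 (component (p := p0) rho0 k) (component (p := p1) rho1 l).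
pose E l m := W2 (component (p := p1) rho1 l) (component (p := p2) rho2 m).
apply: (@le_trans _ _ (\sum_k \sum_m \sum_l
    u k l m * ((s + t) * (D k l ^+ 2 / s + E l m ^+ 2 / t)))).
  apply: ler_sum => k _; apply: ler_sum => m _; rewrite mxE mulr_suml.
  apply: ler_sum => l _; apply: ler_wpM2l => //.
  apply: le_trans (sqr_add2_le _ _ s0 t0).
  rewrite lerXn2r ?nnegrE ?addr_ge0 ?W2_ge0//.
  by apply: W2_triangle; exact: component_in_P2.
have -> : \sum_k \sum_m \sum_l u k l m * ((s + t) * (D k l ^+ 2 / s + E l m ^+ 2 / t)) =
    (s + t) * (plan_cost rho0 rho1 w / s + plan_cost rho1 rho2 v / t).
  transitivity ((s + t) * (\sum_k \sum_l \sum_m u k l m * (D k l ^+ 2 / s)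
     + \sum_l \sum_m \sum_k u k l m * (E l m ^+ 2 / t))).
    rewrite [X in _ = _ * (_ + X)](_ : _ =
      \sum_k \sum_l \sum_m u k l m * (E l m ^+ 2 / t)); last first.
      by under eq_bigr do rewrite exchange_big; rewrite exchange_big.
    rewrite -big_split mulr_sumr; apply: eq_bigr => k _ /=.
    rewrite -big_split mulr_sumr exchange_big; apply: eq_bigr => l _ /=.
    rewrite -big_split mulr_sumr; apply: eq_bigr => m _ /=.
    ring.
  congr (_ * (_ + _)); rewrite mulr_suml; apply: eq_bigr => k _;
    rewrite mulr_suml; apply: eq_bigr => l _; rewrite -mulr_suml.
    by rewrite ur mulrA.
  by rewrite uc mulrA.
rewrite expr2; apply: ler_wpM2l => //; apply: lerD.
  by rewrite ler_pdivrMr// -expr2 cw.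
by rewrite ler_pdivrMr// -expr2 cv.
Qed.

Lemma mixture_distance_eq0 rho0 rho1 p q :
  @is_generator R d rho0 -> @is_generator R d rho1 ->
  mixture_distance rho0 rho1 p q = 0 ->
  meas_eq (mixture_law rho0 p) (mixture_law rho1 q).
Proof.
move=> g0 g1 d0 A mA; rewrite !mixture_law_fine//; congr _%:E.
have [w pw] := mixture_distance_attained rho0 rho1 p q.
rewrite d0 expr0n /=; have [w0 wr wc] := pw => cw.
have term0 k l : w k l * W2 (component rho0 k) (component rho1 l) ^+ 2 = 0.
  have term_ge0 k' l' : 0 <= w k' l' * W2 (component rho0 k') (component rho1 l') ^+ 2.
    by rewrite mulr_ge0 ?sqr_ge0.
  have /psumr_eq0P := cw => /(_ (fun k _ => sumr_ge0 _ (fun l _ => term_ge0 k l))).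
  by move=> /(_ k isT)/psumr_eq0P; apply.
under eq_bigr do rewrite -wr mulr_suml.
under [RHS]eq_bigr do rewrite -wc mulr_suml.
rewrite [RHS]exchange_big; apply: eq_bigr => k _; apply: eq_bigr => l _.
have /eqP := term0 k l; rewrite mulf_eq0 sqrf_eq0 => /orP[/eqP -> |/eqP W0].
  by rewrite !mul0r.
by rewrite (W2_eq0 _ _ W0)//; exact: component_in_P2.
Qed.

End mixture_distance.

(** * Reduced mixtures and identifiability *)

Section reduction.
Context {R : realType} {d : nat}.
Implicit Types (rho : generator R) (p q : mixture R d).
Implicit Types mu nu : set (Rd R d) -> \bar R.

Definition law_invariant (F : (set (Rd R d) -> \bar R) -> R) :=
  forall mu nu, meas_eq mu nu -> F mu = F nu.

(** For suitable F this is the value of the mixture on a set, or the total weight of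
the components equal to a given measure. *)
Definition component_sum rho p F : R :=
  \sum_k weight k * F (component (p := p) rho k).

(** Pick one representative per class of equal components, give it the total weight
of its class, and keep the classes of positive weight.  The conclusion on all
invariant sums yields at once that the law is unchanged and that each component
measure keeps its mass. *)
Lemma exists_reduced rho p : exists2 r : mixture R d, reduced rho r
  & forall F, law_invariant F -> component_sum rho r F = component_sum rho p F.
Proof.
pose same (j k : 'I_(ncomp p)) := `[< meas_eq (component rho j) (component rho k) >].
(* [pick] depends only on the extension of its predicate, so [rep k] depends only
   on the class of [k]. *)
pose rep k := odflt k [pick j | same j k].
have same_rep k : meas_eq (component rho (rep k)) (component rho k).
  rewrite /rep; case: pickP => [j /asboolP //|/(_ k) /asboolP] /=.
  by case; move=> A mA.
have rep_same j k : meas_eq (component rho j) (component rho k) -> rep j = rep k.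
  move=> jk; rewrite /rep (eq_pick (Q := same ^~ k)); last first.
    move=> i; rewrite /same; apply/asboolP/asboolP => h; apply: meas_eq_trans h _ => //.
    exact: meas_eq_sym.
  by case: pickP => // /(_ j) /asboolP.
have rep_rep k : rep (rep k) = rep k by exact: rep_same.
pose m j := \sum_(k | rep k == j) @weight _ _ p k.
have m_ge0 j : 0 <= m j by apply: sumr_ge0 => k _; exact: weight_ge0.
pose S := finset (fun j => (rep j == j) && (0 < m j)).
have sumS (F : 'I_(ncomp p) -> R) : (forall k, F (rep k) = F k) ->
    \sum_(i < #|S|) m (enum_val i) * F (enum_val i) = \sum_k weight k * F k.
  move=> Frep; rewrite (partition_big rep xpredT)//=.
  rewrite -(big_enum_val (fun j => m j * F j)) /= [RHS](bigID (fun j => j \in S)) /=.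
  rewrite [X in _ + X]big1 ?addr0 => [|j jS].
    apply: eq_bigr => j jS; rewrite mulr_suml; apply: eq_bigr => k /eqP kj.
    by rewrite -(Frep k) kj.
  have mj0 : m j = 0.
    have [jj|jj] := eqVneq (rep j) j.
      by apply/eqP; rewrite eq_le m_ge0 andbT leNgt; move: jS; rewrite inE jj eqxx.
    rewrite /m big_pred0// => k; apply/negP => /eqP kj.
    by move: jj; rewrite -kj rep_rep eqxx.
  have /psumr_eq0P := mj0 => /(_ (fun k _ => weight_ge0 k)) w0.
  by rewrite big1// => k kj; rewrite w0// mul0r.
have sum1 : \sum_(i < #|S|) m (enum_val i) = 1.
  have := sumS (fun=> 1) (fun=> erefl).
  by under eq_bigr do rewrite mulr1; under [RHS]eq_bigr do rewrite mulr1; rewrite weight_sum1.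
pose r := @Mixture R d #|S| (fun i => m (enum_val i)) (fun i => Defs.center (enum_val i))
  (fun i => scale (enum_val i)) (fun i => m_ge0 _) sum1 (fun i => scale_gt0 _).
have SP (i : 'I_#|S|) : (rep (enum_val i) == enum_val i) && (0 < m (enum_val i)).
  by have := enum_valP i; rewrite inE.
exists r.
  split=> [i|i j ij same_ij]; first by have /andP[] := SP i.
  have /andP[/eqP ri _] := SP i; have /andP[/eqP rj _] := SP j.
  move: ij => /eqP; apply; apply: enum_val_inj; rewrite -ri -rj.
  exact: rep_same.
move=> F invF; rewrite /component_sum -(sumS (fun k => F (component rho k)))// => k.
exact: invF.
Qed.

(** Reduce both mixtures: the permutation given by identifiability then reindexes
one sum into the other. *)
Lemma identifiable_component_sum rho p q F : @is_generator R d rho ->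
  @identifiable R d rho -> meas_eq (mixture_law rho p) (mixture_law rho q) ->
  law_invariant F -> component_sum rho p F = component_sum rho q F.
Proof.
move=> grho idrho pq invF.
have [r rred rF] := exists_reduced rho p; have [s sred sF] := exists_reduced rho q.
have law_sum (t : mixture R d) A : measurable A ->
    mixture_law rho t A = (component_sum rho t (fun mu => fine (mu A)))%:E.
  by move=> mA; rewrite mixture_law_fine.
have inv_eval A : measurable A -> law_invariant (fun mu => fine (mu A)).
  by move=> mA mu nu h; rewrite h.
have rs : meas_eq (mixture_law rho r) (mixture_law rho s).
  move=> A mA; rewrite !law_sum// rF ?sF; try exact: inv_eval.
  by rewrite -!law_sum// pq.
have [eqK [sigma sigmaP]] := (idrho r s rred sred).1 rs.
rewrite -rF// -sF// /component_sum.
rewrite (reindex_inj (@perm_inj _ sigma)) (reindex (cast_ord eqK)) /=; last first.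
  by apply: onW_bij; exact: Bijective (cast_ordK eqK) (cast_ordKV eqK).
apply: eq_bigr => k _; have [wk ck] := sigmaP k.
by rewrite wk (invF _ _ ck).
Qed.

(** The plan splits the mass of each component measure in proportion to the weights
in p and q.  Its marginals are right because that mass is the same in p and q. *)
Lemma mixture_distance_same_law rho p q : @is_generator R d rho ->
  @identifiable R d rho -> meas_eq (mixture_law rho p) (mixture_law rho q) ->
  mixture_distance rho rho p q = 0.
Proof.
move=> grho idrho pq.
pose same mu nu := (`[< @meas_eq _ (Rd R d) R mu nu >])%:R : R.
have same_ge0 mu nu : 0 <= same mu nu by rewrite ler0n.
have same_inv nu : law_invariant (same ^~ nu).
  move=> mu mu' h; congr (nat_of_bool _)%:R; apply/asboolP/asboolP => h'.
    exact: meas_eq_trans (meas_eq_sym h) h'.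
  exact: meas_eq_trans h h'.
have same_sym mu nu : same mu nu = same nu mu.
  by congr (nat_of_bool _)%:R; apply/asboolP/asboolP; exact: meas_eq_sym.
pose mass nu := component_sum rho p (same ^~ nu).
have massq nu : mass nu = component_sum rho q (same ^~ nu).
  exact: identifiable_component_sum.
have same1 nu : same nu nu = 1 by rewrite /same asboolT.
have mass_inv : law_invariant mass.
  move=> mu nu h; apply: eq_bigr => k _; rewrite ![same (component _ _) _]same_sym.
  by rewrite (same_inv _ _ _ h).
have mass_ge (t : mixture R d) k :
    weight k <= component_sum rho t (same ^~ (component (p := t) rho k)).
  rewrite /component_sum (bigD1 k)//= same1 mulr1 lerDl sumr_ge0// => l _.
  by rewrite mulr_ge0 ?weight_ge0.
have mass_same mu nu : same mu nu / mass mu = same mu nu / mass nu.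
  rewrite /same; case: asboolP => [h|_]; last by rewrite !mul0r.
  by rewrite (mass_inv _ _ h).
have cancel_mass (x y : R) : 0 <= x <= y -> x / y * y = x.
  move=> /andP[x0 xy]; have [y0|y0] := eqVneq y 0; last by rewrite divfK.
  by rewrite y0 mulr0; apply/eqP; rewrite eq_le x0 -y0.
pose w : 'M[R]_(ncomp p, ncomp q) := \matrix_(k, l)
  (weight k * weight l * (same (component rho k) (component rho l) / mass (component rho k))).
have pw : transport_plan w.
  split=> [k l|k|l].
  - rewrite mxE !mulr_ge0 ?weight_ge0// invr_ge0.
    by apply: sumr_ge0 => j _; rewrite mulr_ge0 ?weight_ge0.
  - transitivity (weight k / mass (component rho k) * mass (component rho k)).
      rewrite {2}massq mulr_sumr; apply: eq_bigr => l _; rewrite mxE same_sym; ring.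
    by rewrite cancel_mass// weight_ge0 mass_ge.
  - transitivity (weight l / mass (component rho l) * mass (component rho l)).
      rewrite {2}/mass mulr_sumr; apply: eq_bigr => k _; rewrite mxE mass_same; ring.
    by rewrite cancel_mass// weight_ge0 massq mass_ge.
apply/eqP; rewrite eq_le mixture_distance_ge0 andbT.
apply: (le_trans (mixture_distance_le rho rho pw)).
rewrite /plan_cost big1 ?sqrtr0// => k _; rewrite big1// => l _.
rewrite mxE /same; case: asboolP => [h|_]; last by rewrite mul0r mulr0 mul0r.
by rewrite W2_meas_eq ?expr0n ?mulr0//; exact: component_in_P2.
Qed.

End reduction.

Theorem theorem3p3 (R : realType) (d : nat) (hd : (1 <= d)%N) :
  (forall (rho0 rho1 : generator R) (p0 p1 : mixture R d),
     exists w : 'M[R]_(ncomp p0, ncomp p1), optimal_plan rho0 rho1 w) /\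
  forall rho_of : probability (Rd R d) R -> generator R,
    generator_choice rho_of ->
    exists RW2 : probability (Rd R d) R -> probability (Rd R d) R -> R,
      (forall (mu0 mu1 : probability (Rd R d) R) (p0 p1 : mixture R d)
              (w : 'M[R]_(ncomp p0, ncomp p1)),
         RMM mu0 -> RMM mu1 ->
         meas_eq mu0 (mixture_law (rho_of mu0) p0) ->
         meas_eq mu1 (mixture_law (rho_of mu1) p1) ->
         optimal_plan (rho_of mu0) (rho_of mu1) w ->
         RW2 mu0 mu1 =
           Num.sqrt (\sum_k \sum_l w k l *
             W2 (component (rho_of mu0) k) (component (rho_of mu1) l) ^+ 2)) /\
      is_distance_on (@RMM R d) RW2.
Proof.
split; first exact: exists_optimal_plan.
move=> rho_of [rhoP rho_eq].
have [mix mixP] : {mix : probability (Rd R d) R -> mixture R d &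
    forall mu, RMM mu -> meas_eq mu (mixture_law (rho_of mu) (mix mu))}.
  apply: (@boolp.choice _ _ (fun mu p =>
    RMM mu -> meas_eq mu (mixture_law (rho_of mu) p))) => mu.
  have [/rhoP[_ _ [p pmu]]|nmu] := pselect (RMM mu).
    by exists p.
  (* An arbitrary mixture serves as value outside RMM. *)
  have w1 : \sum_(k < 1) 1 = 1 :> R by rewrite big_ord1.
  exists (@Mixture R d 1 (fun=> 1) (fun=> [tuple 0 | _ < d]) (fun=> 1)
    (fun=> ler01) w1 (fun=> ltr01)).
  by move=> /nmu.
pose D mu nu := mixture_distance (rho_of mu) (rho_of nu) (mix mu) (mix nu).
have gen mu : RMM mu -> @is_generator R d (rho_of mu) by case/rhoP.
have same mu nu p q : RMM mu -> RMM nu -> meas_eq mu nu ->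
    meas_eq mu (mixture_law (rho_of mu) p) -> meas_eq nu (mixture_law (rho_of nu) q) ->
    mixture_distance (rho_of mu) (rho_of nu) p q = 0.
  move=> Mmu Mnu munu mup; rewrite -(rho_eq mu nu)// => nuq.
  have [grho irho _] := rhoP mu Mmu.
  apply: mixture_distance_same_law => //.
  exact: meas_eq_trans (meas_eq_sym mup) (meas_eq_trans munu nuq).
exists D; split.
  move=> mu nu p q w Mmu Mnu mup nuq /mixture_distance_optimal.
  rewrite /plan_cost => <-.
  have le (p0 p1 q0 q1 : mixture R d) :
      meas_eq mu (mixture_law (rho_of mu) p0) -> meas_eq mu (mixture_law (rho_of mu) p1) ->
      meas_eq nu (mixture_law (rho_of nu) q0) -> meas_eq nu (mixture_law (rho_of nu) q1) ->
      mixture_distance (rho_of mu) (rho_of nu) p0 q0 <=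
      mixture_distance (rho_of mu) (rho_of nu) p1 q1.
    move=> mup0 mup1 nuq0 nuq1.
    apply: (le_trans (mixture_distance_triangle p0 p1 q0 (gen _ Mmu) (gen _ Mmu) (gen _ Mnu))).
    rewrite (same mu mu)// add0r.
    apply: (le_trans (mixture_distance_triangle p1 q1 q0 (gen _ Mmu) (gen _ Mnu) (gen _ Mnu))).
    by rewrite (same nu nu)// addr0.
  by apply/eqP; rewrite eq_le !le//; exact: mixP.
split.
- by move=> mu nu _ _; exact: mixture_distance_ge0.
- move=> mu nu Mmu Mnu; split=> [|munu]; last by apply: same => //; exact: mixP.
  move=> /(mixture_distance_eq0 (gen _ Mmu) (gen _ Mnu)) laws.
  exact: meas_eq_trans (mixP _ Mmu) (meas_eq_trans laws (meas_eq_sym (mixP _ Mnu))).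
- by move=> mu nu _ _; exact: mixture_distance_sym.
- by move=> mu nu xi Mmu Mnu Mxi; apply: mixture_distance_triangle; exact: gen.
Qed.
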